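(* Let $C\in\mathcal{C}_n$ be an $n$-cycle. If $NM_\mu(C)< n-2$, then $NMplot(C)$ is a Ferrers diagram, i.e. there is a (possibly empty) integer partition $\lambda$ with $NMplot(C)=FD_n(\lambda)$.
   Context: $\mathcal{C}_n$ is the set of $n$-cycles in the symmetric group $S_n$. An $n$-cycle is written $C=(c_0,c_1,\dots,c_{n-1})$ with $c_0=1$, viewed as a cyclic arrangement of $\{1,\dots,n\}$. We say $c_s$ is cyclically between $c_i$ and $c_j$ if $i<s<j$, or $j<i<s$, or $s<j<i$. A pair $\langle a,b\rangle$ with $1\le a<b\le n$ is a non-$\mu$-match of $C$ if there exists an integer $x$ with $a<x<b$ that is cyclically between $a$ and $b$ in $C$. $\mathcal{NM}_\mu(C)$ is the set of non-$\mu$-matches of $C$ and $NM_\mu(C)=|\mathcal{NM}_\mu(C)|$. Consider an $n\times n$ grid with rows labeled $1,\dots,n$ from bottom to top and columns labeled $1,\dots,n$ from left to right. $NMplot(C)$ is the diagram obtained by shading the cell in row $j$ and column $i$ if and only if $\langle i,j\rangle\in\mathcal{NM}_\mu(C)$. For a partition $\lambda=(\lambda_1\ge\lambda_2\ge\dots\ge\lambda_\ell>0)$, its Ferrers diagram $FD_n(\lambda)$ on the $n\times n$ grid is obtained by shading, for each $i=1,\dots,\ell$, the cells in columns $1,\dots,\lambda_i$ of the $i$th row from the top (row $n-i+1$); the empty partition has no shaded cells. *)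

(* Defs.v *)
From mathcomp Require Import all_boot perm.

Set Implicit Arguments.
Unset Strict Implicit.
Unset Printing Implicit Defensive.

(* The integers 1, ..., n.+1 are represented by 'I_n.+1, the ordinal i        *)
(* standing for the label i + 1; in particular ord0 is the label 1. Rows and  *)
(* columns of the grid are labelled in the same way.                          *)

Definition ncycles (n : nat) : {set 'S_n} :=
  [set C : 'S_n | porbits C == [set [set: 'I_n]]].

Definition cycle_entry (n : nat) (C : 'S_n.+1) (k : nat) : 'I_n.+1 :=
  iter k C ord0.

(* x is met strictly between a and b when reading (c_0, c_1, ...) cyclically  *)
(* from a to b.                                                               *)
Definition cyclically_between (n : nat) (C : 'S_n.+1) (x a b : 'I_n.+1) :
    bool :=
  [exists i : 'I_n.+1, exists s : 'I_n.+1, exists j : 'I_n.+1,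
    [&& cycle_entry C i == a, cycle_entry C s == x, cycle_entry C j == b
      & [|| (i < s) && (s < j), (j < i) && (i < s) | (s < j) && (j < i)]]].

Definition non_mu_match (n : nat) (C : 'S_n.+1) (a b : 'I_n.+1) : bool :=
  (a < b) &&
  [exists x : 'I_n.+1, [&& a < x, x < b & cyclically_between C x a b]].

Definition NMset (n : nat) (C : 'S_n.+1) : {set 'I_n.+1 * 'I_n.+1} :=
  [set p | non_mu_match C p.1 p.2].

Definition NM (n : nat) (C : 'S_n.+1) : nat := #|NMset C|.

(* A cell is a pair (row, column), rows being numbered from bottom to top:    *)
(* the pair <i, j> shades the cell in row j and column i.                     *)
Definition NMplot (n : nat) (C : 'S_n.+1) : {set 'I_n.+1 * 'I_n.+1} :=
  [set rc : 'I_n.+1 * 'I_n.+1 | (rc.2, rc.1) \in NMset C].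

(* The parts of a partition in weakly decreasing order; [::] is the empty     *)
(* partition.                                                                 *)
Definition is_partition (la : seq nat) : bool :=
  sorted geq la && all (fun m => 0 < m) la.

Definition fits_in_grid (n : nat) (la : seq nat) : bool :=
  (size la <= n) && all (fun m => m <= n) la.

(* rev_ord r is the 0-based index of row r counted from the top, so the part  *)
(* attached to row r is the entry of la at that index.                        *)
Definition FD (n : nat) (la : seq nat) : {set 'I_n * 'I_n} :=
  [set rc : 'I_n * 'I_n | (rev_ord rc.1 < size la) &&
    (rc.2 < nth 0 la (rev_ord rc.1))].

(* Main.v *)
Require Import Defs.
From mathcomp Require Import all_boot perm.
From mathcomp Require Import zify.

Set Implicit Arguments.
Unset Strict Implicit.
Unset Printing Implicit Defensive.

(* If the plot were not closed under moving up or left, the cycle would       *)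
(* contain labels p1 < p2 < p3 < p4 in the cyclic order p1, p4, p2, p3 with   *)
(* <p1, p4> a match. Every label z other than p1 and p2 then forms a          *)
(* non-match with one of the p's, and these n - 2 non-matches are distinct.   *)

(** A set of cells closed under moving up and left is a Ferrers diagram ([up_left_closed_FD]). Both
    closures come from one count, [NM_lower_bound]: a non-match <a, b> together with a match <a, y>,
    y > b, or a match <w, b>, w < a, yields the four labels above, hence at least n - 2 non-matches,
    n being the number of labels, against the hypothesis. The count splits on where z falls among
    the p's in value; the [cyc3] lemmas then locate z in the cycle. *)

Definition cyc3 (i s j : nat) : bool :=
  [|| (i < s) && (s < j), (j < i) && (i < s) | (s < j) && (j < i)].

Lemma cyc3N (i s j : nat) : i != s -> s != j -> i != j ->
  ~~ cyc3 i s j -> cyc3 i j s.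
Proof. by rewrite /cyc3; lia. Qed.

(** Reading from w, both a and x come after b; the cyclic order a, x, b then puts a before x. *)
Lemma cyc3_insert (w a x b : nat) :
  cyc3 a x b -> cyc3 w b a -> cyc3 w b x -> cyc3 w a x.
Proof. by rewrite /cyc3; lia. Qed.

Lemma cyc3_linear (a b c d : nat) : cyc3 a b c -> cyc3 a c d ->
  [|| [&& a < b, b < c & c < d], [&& b < c, c < d & d < a],
      [&& c < d, d < a & a < b] | [&& d < a, a < b & b < c]].
Proof. by rewrite /cyc3; lia. Qed.

(** In this and the next two lemmas, a, b, c, d are the positions of p1, p4, p2, p3, in cyclic
    order, and q is that of z. The first alternative fails only on the arc from c to d, and from
    there one meets d, then a, then b. *)
Lemma cyc3_left_end (q a b c d : nat) : cyc3 a b c -> cyc3 a c d ->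
  q != a -> q != b -> q != c -> q != d -> cyc3 q c d || cyc3 q d b.
Proof.
move=> h1 h2; case/or4P: (cyc3_linear h1 h2) => /and3P[];
by rewrite /cyc3; clear; lia.
Qed.

(** With the arc from a to b excluded, q d b holds on the arcs from b to d, and a c q on the arc
    from d to a. *)
Lemma cyc3_mid (q a b c d : nat) : cyc3 a b c -> cyc3 a c d ->
  q != a -> q != b -> q != c -> q != d -> ~~ cyc3 a q b ->
  cyc3 q d b || cyc3 a c q.
Proof.
move=> h1 h2; case/or4P: (cyc3_linear h1 h2) => /and3P[];
by rewrite /cyc3; clear; lia.
Qed.

Lemma cyc3_right_end (q a b c d : nat) : cyc3 a b c -> cyc3 a c d ->
  q != a -> q != b -> q != c -> q != d -> cyc3 c d q || cyc3 a c q.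
Proof.
move=> h1 h2; case/or4P: (cyc3_linear h1 h2) => /and3P[];
by rewrite /cyc3; clear; lia.
Qed.

Section Cycle.

Variables (n : nat) (C : 'S_n.+1).
Hypothesis hC : C \in ncycles n.+1.

Definition cycle_pos (x : 'I_n.+1) : nat := index x (traject C ord0 n.+1).

Lemma porbit_ncycle : porbit C ord0 = [set: 'I_n.+1].
Proof.
move: hC; rewrite inE => /eqP hp.
by apply/set1P; rewrite -hp; apply: imset_f.
Qed.

Lemma mem_traject_ncycle x : x \in traject C ord0 n.+1.
Proof.
by have := porbit_traject C ord0 x; rewrite porbit_ncycle inE cardsT card_ord.
Qed.

Lemma uniq_traject_ncycle : uniq (traject C ord0 n.+1).
Proof.
by have := uniq_traject_porbit C ord0; rewrite porbit_ncycle cardsT card_ord.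
Qed.

Lemma cycle_pos_lt x : cycle_pos x < n.+1.
Proof. by have := mem_traject_ncycle x; rewrite -index_mem size_traject. Qed.

Lemma cycle_posK x : cycle_entry C (cycle_pos x) = x.
Proof.
rewrite /cycle_entry -(nth_traject C (cycle_pos_lt x)).
exact: nth_index (mem_traject_ncycle x).
Qed.

Lemma cycle_entryK (i : 'I_n.+1) : cycle_pos (cycle_entry C i) = i.
Proof.
rewrite /cycle_entry -(nth_traject C (ltn_ord i)) /cycle_pos.
by rewrite index_uniq ?size_traject ?uniq_traject_ncycle.
Qed.

Lemma cycle_pos_inj : injective cycle_pos.
Proof. exact: can_inj cycle_posK. Qed.

(** In a single cycle each label has exactly one position, so the choice of indices is forced and
    betweenness becomes arithmetic on positions. *)
Lemma cyclically_betweenE x a b :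
  cyclically_between C x a b = cyc3 (cycle_pos a) (cycle_pos x) (cycle_pos b).
Proof.
apply/existsP/idP => [[i] /existsP[s] /existsP[j] | h].
  by case/and4P=> /eqP<- /eqP<- /eqP<-; rewrite !cycle_entryK.
exists (Ordinal (cycle_pos_lt a)); apply/existsP.
exists (Ordinal (cycle_pos_lt x)); apply/existsP.
by exists (Ordinal (cycle_pos_lt b)); rewrite !cycle_posK !eqxx.
Qed.

Lemma non_mu_matchP (a b : 'I_n.+1) :
  reflect (exists x : 'I_n.+1,
             [/\ a < x, x < b & cyc3 (cycle_pos a) (cycle_pos x) (cycle_pos b)])
          (non_mu_match C a b).
Proof.
apply: (iffP andP) => [[_ /existsP[x /and3P[ax xb]]] | [x [ax xb h]]].
  by rewrite cyclically_betweenE; exists x.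
split; first exact: ltn_trans xb.
by apply/existsP; exists x; rewrite ax xb cyclically_betweenE.
Qed.

Lemma NM_lower_bound (p1 p2 p3 p4 : 'I_n.+1) :
  p1 < p2 -> p2 < p3 -> p3 < p4 ->
  cyc3 (cycle_pos p1) (cycle_pos p4) (cycle_pos p2) ->
  cyc3 (cycle_pos p1) (cycle_pos p2) (cycle_pos p3) ->
  ~~ non_mu_match C p1 p4 -> n.+1 - 2 <= NM C.
Proof.
move=> p12 p23 p34 c142 c123 m14.
(* [h] recovers z from its non-match with one of the p's, so distinctness comes for free: it
   suffices that the image of [NMset C] under [h] contains every label but p1 and p2. When both
   entries are p's, [h] returns the larger label, which serves z = p3 and z = p4. *)
pose h (p : 'I_n.+1 * 'I_n.+1) :=
  if p.1 \in [set p1; p2; p3; p4] then p.2 else p.1.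
have -> : n.+1 - 2 = #|~: [set p1; p2]|.
  have ne : p1 != p2 by rewrite neq_ltn p12.
  by have := cardsC [set p1; p2]; rewrite cards2 ne card_ord; lia.
apply: leq_trans (leq_imset_card h (mem (NMset C))).
apply/subset_leq_card/subsetP => z; rewrite !inE negb_or => /andP[z1 z2].
have left_end (i w : 'I_n.+1) : z \notin [set p1; p2; p3; p4] ->
    z < w -> w < i -> cyc3 (cycle_pos z) (cycle_pos w) (cycle_pos i) ->
    z \in h @: NMset C.
  move=> zP zw wi c; apply/imsetP; exists (z, i); last by rewrite /h (negbTE zP).
  by rewrite inE /=; apply/non_mu_matchP; exists w.
have right_end (i w : 'I_n.+1) : i \in [set p1; p2; p3; p4] ->
    i < w -> w < z -> cyc3 (cycle_pos i) (cycle_pos w) (cycle_pos z) ->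
    z \in h @: NMset C.
  move=> iP iw wz c; apply/imsetP; exists (i, z); last by rewrite /h iP.
  by rewrite inE /=; apply/non_mu_matchP; exists w.
have pos_neq (i : 'I_n.+1) : z != i -> cycle_pos z != cycle_pos i.
  by rewrite (inj_eq cycle_pos_inj).
have [->|z3] := eqVneq z p3.
  apply/imsetP; exists (p1, p3); last by rewrite /h !inE eqxx.
  by rewrite inE /=; apply/non_mu_matchP; exists p2.
have [->|z4] := eqVneq z p4.
  apply/imsetP; exists (p2, p4); last by rewrite /h !inE eqxx orbT.
  rewrite inE /=; apply/non_mu_matchP; exists p3; split=> //.
  by move: c142 c123; rewrite /cyc3; clear; lia.
have zP : z \notin [set p1; p2; p3; p4].
  by rewrite !inE (negbTE z1) (negbTE z2) (negbTE z3) (negbTE z4).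
have p1P : p1 \in [set p1; p2; p3; p4] by rewrite !inE eqxx.
have p2P : p2 \in [set p1; p2; p3; p4] by rewrite !inE eqxx orbT.
have [q1 q2 q3 q4] := And4 (pos_neq _ z1) (pos_neq _ z2)
                           (pos_neq _ z3) (pos_neq _ z4).
have [z_lt2|z_gt2|/val_inj z_eq2] := ltngtP z p2; last by rewrite z_eq2 eqxx in z2.
  have /orP[c|c] := cyc3_left_end c142 c123 q1 q4 q2 q3.
    exact: left_end c.
  exact: left_end (ltn_trans z_lt2 p23) p34 c.
have [z_lt3|z_gt3|/val_inj z_eq3] := ltngtP z p3; last by rewrite z_eq3 eqxx in z3.
  (* Here the match <p1, p4> is used: z has a value between p1 and p4, so it cannot lie between them
     in the cycle. *)
  have notin14 : ~~ cyc3 (cycle_pos p1) (cycle_pos z) (cycle_pos p4).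
    apply: contra m14 => c; apply/non_mu_matchP; exists z; split=> //.
      exact: ltn_trans z_gt2.
    exact: ltn_trans p34.
  have /orP[c|c] := cyc3_mid c142 c123 q1 q4 q2 q3 notin14.
    exact: left_end c.
  exact: right_end c.
have /orP[c|c] := cyc3_right_end c142 c123 q1 q4 q2 q3.
  exact: right_end c.
exact: right_end (ltn_trans p23 z_gt3) c.
Qed.

Hypothesis hNM : NM C < n.+1 - 2.

(** If <a, y> were a match, the witness x of <a, b> would come after y when reading from a, so a < x
    < b < y would be in cyclic order a, y, x, b. *)
Lemma non_mu_match_up (a b y : 'I_n.+1) :
  b <= y -> non_mu_match C a b -> non_mu_match C a y.
Proof.
rewrite leq_eqVlt => /orP[/eqP/val_inj -> //|b_y] ab.
apply/negPn/negP => ay; move: hNM; rewrite ltnNge => /negP; apply.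
case/non_mu_matchP: ab => x [ax xb c].
have not_between (z : 'I_n.+1) : a < z -> z < y ->
    cyc3 (cycle_pos a) (cycle_pos y) (cycle_pos z).
  move=> az zy; apply: cyc3N; rewrite ?(inj_eq cycle_pos_inj) ?neq_ltn.
  - by rewrite az.
  - by rewrite zy.
  - by rewrite (ltn_trans az zy).
  - by apply: contra ay => h; apply/non_mu_matchP; exists z.
exact: NM_lower_bound ax xb b_y (not_between x ax (ltn_trans xb b_y)) c ay.
Qed.

(** Here the four labels are w < a < x < b, in cyclic order w, b, a, x. *)
Lemma non_mu_match_left (a b w : 'I_n.+1) :
  w <= a -> non_mu_match C a b -> non_mu_match C w b.
Proof.
rewrite leq_eqVlt => /orP[/eqP/val_inj -> //|wa] ab.
apply/negPn/negP => wb; move: hNM; rewrite ltnNge => /negP; apply.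
case/non_mu_matchP: ab => x [ax xb c].
have not_between (z : 'I_n.+1) : w < z -> z < b ->
    cyc3 (cycle_pos w) (cycle_pos b) (cycle_pos z).
  move=> wz zb; apply: cyc3N; rewrite ?(inj_eq cycle_pos_inj) ?neq_ltn.
  - by rewrite wz.
  - by rewrite zb.
  - by rewrite (ltn_trans wz zb).
  - by apply: contra wb => h; apply/non_mu_matchP; exists z.
have wba := not_between a wa (ltn_trans ax xb).
have wbx := not_between x (ltn_trans wa ax) xb.
exact: NM_lower_bound wa ax xb wba (cyc3_insert c wba wbx) wb.
Qed.

End Cycle.

(** The zeros of a weakly decreasing sequence form its tail, where the default 0 replaces them. *)
Lemma nth_filter_gt0 (s : seq nat) i :
  sorted geq s -> nth 0 [seq m <- s | 0 < m] i = nth 0 s i.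
Proof.
have geq_trans : transitive geq by move=> y x z /= h1 h2; apply: leq_trans h1.
elim: s i => //= m s IHs i ms; have ss := path_sorted ms.
case: m ms => [|m] ms /=; last by case: i => //= i; apply: IHs.
have s0 : all (geq 0) s by apply: order_path_min ms.
rewrite (IHs _ ss); case: i => [|i] /=.
  by case: s s0 {IHs ms ss} => //= m s /andP[]; rewrite leqn0 => /eqP.
have nth0 j : nth 0 s j = 0.
  have [lt_j|ge_j] := ltnP j (size s); last exact: nth_default.
  by apply/eqP; rewrite -leqn0; apply: (all_nthP 0 s0).
by rewrite !nth0.
Qed.

(** A down-closed set contains all of 0, ..., c if it contains c, and lies strictly below c
    otherwise; compare cardinals. *)
Lemma downset_ordE (N : nat) (A : {set 'I_N}) (c : 'I_N) :
  (forall i j : 'I_N, i <= j -> j \in A -> i \in A) -> (c \in A) = (c < #|A|).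
Proof.
move=> dA; have card_lt (k : nat) : k <= N -> #|[set i : 'I_N | i < k]| = k.
  move=> kN; have w_inj : injective (widen_ord kN).
    by move=> i j /(congr1 val) /= /val_inj.
  rewrite -[RHS]card_ord -cardsT -(card_imset _ w_inj).
  apply: eq_card => i; rewrite inE; apply/idP/imsetP => [ik | [j _ ->]].
    by exists (Ordinal ik) => //; apply: val_inj.
  exact: (ltn_ord j).
apply/idP/idP => [cA | ].
  rewrite -[c.+1]card_lt //; apply/subset_leq_card/subsetP => i.
  by rewrite inE ltnS => ic; apply: dA cA.
apply: contraTT => cA; rewrite -leqNgt -[leqRHS](card_lt c (ltnW (ltn_ord c))).
apply/subset_leq_card/subsetP => i iA; rewrite inE ltnNge.
by apply: contra cA => ci; apply: dA iA.
Qed.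

Lemma up_left_closed_FD (n : nat) (S : {set 'I_n.+1 * 'I_n.+1}) :
  (forall r r' c c' : 'I_n.+1,
     r <= r' -> c' <= c -> (r, c) \in S -> (r', c') \in S) ->
  exists la : seq nat,
    [/\ is_partition la, fits_in_grid n.+1 la & S = FD n.+1 la].
Proof.
move=> upS; pose row r := [set c | (r, c) \in S].
have rowE r c : ((r, c) \in S) = (c < #|row r|).
  rewrite -downset_ordE ?inE // => i j ij; rewrite !inE.
  exact: upS.
(* The row lengths from the top down, zeros included; closure upwards makes them weakly
   decreasing. *)
pose s := mkseq (fun i => #|row (rev_ord (inord i : 'I_n.+1))|) n.+1.
have s_sorted : sorted geq s.
  apply/(sortedP 0) => i; rewrite size_mkseq => lt_i.
  rewrite !nth_mkseq //; last exact: ltnW.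
  apply/subset_leq_card/subsetP => c; rewrite !inE; apply: upS => //=.
  by apply: leq_sub2l; rewrite !inordK // ltnW.
have geq_trans : transitive geq by move=> y x z /= h1 h2; apply: leq_trans h1.
exists [seq m <- s | 0 < m]; split.
- by rewrite /is_partition sorted_filter // filter_all.
- have le_size : size [seq m <- s | 0 < m] <= n.+1.
    by rewrite size_filter (leq_trans (count_size _ _)) ?size_mkseq.
  rewrite /fits_in_grid le_size.
  apply/allP => m; rewrite mem_filter => /andP[_ /mapP[i _ ->]].
  by rewrite (leq_trans (max_card _)) ?card_ord.
apply/setP => -[r c]; rewrite inE /=.
have nthE : nth 0 [seq m <- s | 0 < m] (n.+1 - r.+1) = #|row r|.
  rewrite nth_filter_gt0 // nth_mkseq; last exact: ltn_ord (rev_ord r).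
  by rewrite [inord _](inord_val (rev_ord r)) rev_ordK.
(* Beyond the last part [nth] returns 0, so the size condition in [FD] follows from the column
   condition. *)
rewrite andb_idl => [|lt_c]; first by rewrite nthE rowE.
by rewrite ltnNge; apply: contraTN lt_c => le_size; rewrite nth_default.
Qed.

Theorem corollary14 (n : nat) (C : 'S_n.+1) (hC : C \in ncycles n.+1)
    (hNM : NM C < n.+1 - 2) :
  exists la : seq nat,
    [/\ is_partition la, fits_in_grid n.+1 la & NMplot C = FD n.+1 la].
Proof.
apply: up_left_closed_FD => r r' c c' rr cc; rewrite !inE /= => cr.
exact: (non_mu_match_left hC hNM cc (non_mu_match_up hC hNM rr cr)).
Qed.
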